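(* Let $D,r,Q$ be positive integers and $\epsilon>0$. There exists a positive integer $q=q(D,r,Q,\epsilon)$ such that the following holds for every $\delta\in(0,1]$. Let $P:\mathbb{Z}\to\mathbb{Z}^r$, $P(n)=(P_1(n),\dots,P_r(n))$ with $P_i\in\mathbb{Z}[n]$, $\deg P_i\le D$, have multiplicative complexity $Q$ and hyperplane-fleeing image. Let $T:\mathbb{Z}^r\curvearrowright(X,\mu)$ be an ergodic measure preserving action and $B\subset X$ be $(q,\delta)$-equidistributed. Then $$\limsup_{N\to\infty}\Big\|\mu(B)-\frac1N\sum_{n=1}^N T^{P(n)}\mathbb{1}_B\Big\|_2\le\sqrt{3\delta}+\epsilon.$$
   Context: $T^vf:=f\circ T^v$. A polynomial map $P$ has multiplicative complexity $Q$ if for all $\vec a\in\mathbb{Z}^r$, $q\in\mathbb{Z}$ with $\gcd(a_1,\dots,a_r,q)=1$, writing $(P(n)-P(0))\cdot\vec a=\sum_{j\ge1}b_jn^j$, one has $\gcd(b_1,\dots,b_D,q)\le Q$. A subset of $\mathbb{R}^r$ is hyperplane-fleeing if it is not contained in any proper affine subspace. With $F_n=[1,n]^r\cap\mathbb{Z}^r$, $B$ is $(q,\delta)$-equidistributed if for $\mu$-a.e. $x$, $\lim_{n\to\infty}\frac{1}{|F_n|}|\{a\in F_n:T^{qa}x\in B\}|\le(1+\delta)\mu(B)$. *)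

(* Defs.v *)
From HB Require Import structures.
From mathcomp Require Import all_boot all_order all_algebra.
From mathcomp Require Import all_classical all_reals all_analysis.
Set Implicit Arguments. Unset Strict Implicit. Unset Printing Implicit Defensive.
Import Order.TTheory GRing.Theory Num.Theory numFieldNormedType.Exports.
Local Open Scope classical_set_scope.
Local Open Scope ring_scope.

Definition polymap (r : nat) (P : 'I_r -> {poly int}) (n : int) : 'rV[int]_r :=
  \row_i (P i).[n].

Definition gcd_family (I : finType) (a : I -> int) : nat :=
  \big[gcdn/0%N]_(i : I) `|a i|%N.

Definition mult_complexity (D r : nat) (P : 'I_r -> {poly int}) (Q : nat) : Prop :=
  forall (a : 'I_r -> int) (q : int),
    gcdn (gcd_family a) `|q|%N = 1%N ->
    let b := \sum_(i < r) a i *: (P i - ((P i)`_0)%:P) in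
    (gcdn (\big[gcdn/0%N]_(1 <= j < D.+1) absz (b`_j)%R) `|q|%N <= Q)%N.

Definition hyperplane_fleeing (R : realType) (r : nat) (P : 'I_r -> {poly int}) : Prop :=
  ~ exists (x0 : 'rV[R]_r) (V : {vspace 'rV[R]_r}),
      V != fullv /\ forall n : int, map_mx intr (polymap P n) - x0 \in V.

Definition mp_action d (X : measurableType d) (R : realType)
    (mu : {measure set X -> \bar R}) (r : nat) (T : 'rV[int]_r -> X -> X) : Prop :=
  [/\ T 0 = id,
      forall u v, T (u + v) = T u \o T v,
      forall v, measurable_fun setT (T v) &
      forall v A, measurable A -> mu (T v @^-1` A) = mu A].

Definition ergodic_action d (X : measurableType d) (R : realType)
    (mu : {measure set X -> \bar R}) (r : nat) (T : 'rV[int]_r -> X -> X) : Prop :=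
  forall A, measurable A -> (forall v, T v @^-1` A = A) ->
    mu A = 0%E \/ mu A = 1%E.

Definition freq d (X : measurableType d) (R : realType) (r : nat)
    (T : 'rV[int]_r -> X -> X) (q : nat) (B : set X) (x : X) (n : nat) : R :=
  ((n%:R ^+ r)^-1 *
   \sum_(a : {ffun 'I_r -> 'I_n}) \1_B (T (\row_i ((q * (a i).+1)%N%:Z)) x))%R.

Definition equidistributed d (X : measurableType d) (R : realType)
    (mu : {measure set X -> \bar R}) (r : nat) (T : 'rV[int]_r -> X -> X)
    (q : nat) (delta : R) (B : set X) : Prop :=
  {ae mu, forall x, exists L : R,
     @freq d X R r T q B x @ \oo --> L /\ (L%:E <= (1 + delta)%:E * mu B)%E}.

(* the function mu(B) - (1/N) sum_{n=1}^N T^{P(n)} 1_B, where T^v f := f o T^v *)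
Definition ergavg d (X : measurableType d) (R : realType)
    (mu : {measure set X -> \bar R}) (r : nat) (T : 'rV[int]_r -> X -> X)
    (P : 'I_r -> {poly int}) (B : set X) (N : nat) (x : X) : R :=
  fine (mu B) - N%:R^-1 * \sum_(1 <= n < N.+1) \1_B (T (polymap P n%:Z) x).

(* Main.v *)
Require Import Defs.
From HB Require Import structures.
From mathcomp Require Import all_boot all_order all_algebra.
From mathcomp Require Import all_classical all_reals all_analysis.
From mathcomp Require Import measurable_realfun ring lra zify.
Set Implicit Arguments. Unset Strict Implicit. Unset Printing Implicit Defensive.
Import Order.TTheory GRing.Theory Num.Theory.
Local Open Scope classical_set_scope.
Local Open Scope ring_scope.

(** Let an abelian group act by linear isometries on a space with a semi-definite
form, and let [p n] be the sum of the [c j *+ n ^ j] for [j <= D]. By induction on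
[D], there is a [q] depending only on [D] and [eps] such that the averages of the
[p n]-translates of a unit vector [f] are eventually at most [eps] in norm as soon as
[f] averages to 0 along the group generated by the [q c_j], [1 <= j <= D]. To see this,
split [f] into a part that is nearly invariant under the [q c_j] with [j >= 2] and a
part that averages to 0 along the group they generate. On the latter, van der Corput's
inequality with a bounded number of differences [p (n + k) - p n] reduces the degree,
and the group generated by the new coefficients contains the old [q c_j], [j >= 2], for
a suitable [q]. On the former, [p (n + q a)] acts nearly as [p n + q a c_1], so
its averages are controlled by the averages of [f] along the group.

For the theorem, the multiplicative complexity bound says that [Q`! Z^r] lies in the
lattice spanned by the coefficients of [P]. Let [f'] be an average of the indicator of
[B] along [q Z^r] of nearly minimal norm; then the difference averages to 0
along [q Z^r], while the norm of [f'] is nearly at most that of the box averages, which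
equidistribution bounds by [(1 + delta) mu(B)^2], so that [f'] is close to the
constant [mu(B)]. *)

(** * Averages under isometric actions *)

(** The form is only semi-definite, so that bounded measurable functions form an instance without a
    quotient by null functions or a completion. *)
Record isometric_action (R : realType) (V : lmodType R) (G : zmodType)
    (B : V -> V -> R) (U : G -> V -> V) : Prop := IsometricAction {
  formC : forall x y, B x y = B y x;
  form_linear : forall a x y z, B (a *: x + y) z = a * B x z + B y z;
  form_ge0 : forall x, 0 <= B x x;
  act0 : forall x, U 0 x = x;
  actD : forall u v x, U (u + v) x = U u (U v x);
  act_linear : forall u a x y, U u (a *: x + y) = a *: U u x + U u y;
  act_isometry : forall u x y, B (U u x) (U u y) = B x y }.

Definition avg (R : realType) (V : lmodType R) (N : nat) (x : nat -> V) : V :=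
  N%:R^-1 *: \sum_(n < N) x n.

Definition savg (R : realType) (V : lmodType R) (G : zmodType)
    (U : G -> V -> V) (s : seq G) (f : V) : V :=
  (size s)%:R^-1 *: \sum_(v <- s) U v f.

Definition nrm (R : realType) (V : lmodType R) (B : V -> V -> R) (x : V) : R :=
  Num.sqrt (B x x).

Definition subgroup (G : zmodType) (L : set G) : Prop :=
  L 0 /\ forall u v, L u -> L v -> L (u - v).

(** The empty list must be excluded: its average is 0, which would make every vector [null]. *)
Definition drawn_from (G : zmodType) (L : set G) (s : seq G) : Prop :=
  (0 < size s)%N /\ forall v, v \in s -> L v.

(* In a Hilbert space: the projection of [f] to the [L]-invariant vectors is 0. *)
Definition null (R : realType) (V : lmodType R) (G : zmodType)
    (B : V -> V -> R) (U : G -> V -> V) (L : set G) (f : V) : Prop :=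
  forall tau : R, 0 < tau -> exists s, drawn_from L s /\ nrm B (savg U s f) <= tau.

Section IsometricAction.
Variables (R : realType) (V : lmodType R) (G : zmodType).
Variables (B : V -> V -> R) (U : G -> V -> V).
Hypothesis BU : isometric_action B U.
Local Notation nrm := (nrm B).
Local Notation null := (null B U).
Local Notation savg := (savg U).

(** * The semi-definite form and its seminorm *)

Lemma formDl x y z : B (x + y) z = B x z + B y z.
Proof. by rewrite -{1}[x]scale1r (form_linear BU) mul1r. Qed.

Lemma form0l z : B 0 z = 0.
Proof. by apply: (addrI (B 0 z)); rewrite -formDl !addr0. Qed.

Lemma formZl a x z : B (a *: x) z = a * B x z.
Proof. by rewrite -[a *: x]addr0 (form_linear BU) form0l addr0. Qed.

Lemma formDr x y z : B z (x + y) = B z x + B z y.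
Proof. by rewrite (formC BU) formDl ![B _ z](formC BU). Qed.

Lemma formZr a x z : B z (a *: x) = a * B z x.
Proof. by rewrite (formC BU) formZl [B x z](formC BU). Qed.

Lemma form_suml (I : Type) (r : seq I) (P : pred I) (x : I -> V) z :
  B (\sum_(i <- r | P i) x i) z = \sum_(i <- r | P i) B (x i) z.
Proof. by apply: (big_morph (B^~ z) _ (form0l z)) => a b; exact: formDl. Qed.

Lemma form_sumr (I : Type) (r : seq I) (P : pred I) (x : I -> V) z :
  B z (\sum_(i <- r | P i) x i) = \sum_(i <- r | P i) B z (x i).
Proof.
by rewrite (formC BU) form_suml; apply: eq_bigr => i _; rewrite (formC BU).
Qed.

Lemma nrmE x : nrm x = Num.sqrt (B x x). Proof. by []. Qed.

Lemma savgE s f : savg s f = (size s)%:R^-1 *: \sum_(v <- s) U v f.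
Proof. by []. Qed.

Lemma nrm_ge0 x : 0 <= nrm x. Proof. exact: sqrtr_ge0. Qed.

Lemma nrm_sqr x : nrm x ^+ 2 = B x x.
Proof. by rewrite sqr_sqrtr// (form_ge0 BU). Qed.

Lemma form_sqrD x y (a b : R) : B (a *: x + b *: y) (a *: x + b *: y) =
  a ^+ 2 * B x x + 2 * (a * b) * B x y + b ^+ 2 * B y y.
Proof.
rewrite formDl !formDr !formZl !formZr [B y x](formC BU); ring.
Qed.

Lemma form_AMGM x y : 2 * B x y <= B x x + B y y.
Proof.
have := form_ge0 BU (1 *: x + (-1) *: y); rewrite form_sqrD; lra.
Qed.

Lemma form_cauchy_schwarz x y : B x y <= nrm x * nrm y.
Proof.
(* Vectors of norm 0 need their own argument: if [B u v] were positive, [u - t v] would have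
   negative square for this small [t]. *)
have CS0 u v : B u u = 0 -> B u v <= 0.
  move=> u0; rewrite leNgt; apply/negP => uv.
  have v0 := form_ge0 BU v.
  have d0 : 0 < B v v + 1 by lra.
  have := form_ge0 BU (1 *: u + (- (B u v / (B v v + 1))) *: v).
  set t := B u v / _.
  have tE : t * (B v v + 1) = B u v by rewrite /t divfK// gt_eqF.
  have t0 : 0 < t by rewrite divr_gt0.
  rewrite form_sqrD u0 -tE; nra.
have := nrm_ge0 x; rewrite le_eqVlt => /orP[/eqP x0|x0].
  by rewrite -x0 mul0r; apply: CS0; rewrite -nrm_sqr -x0 expr0n.
have := nrm_ge0 y; rewrite le_eqVlt => /orP[/eqP y0|y0].
  by rewrite -y0 mulr0 (formC BU); apply: CS0; rewrite -nrm_sqr -y0 expr0n.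
have := form_ge0 BU (nrm y *: x + (- nrm x) *: y).
rewrite form_sqrD -!nrm_sqr => h.
have ab : 0 < nrm x * nrm y by rewrite mulr_gt0.
rewrite -(ler_pM2l ab); nra.
Qed.

Lemma nrmD x y : nrm (x + y) <= nrm x + nrm y.
Proof.
rewrite -(@ler_pXn2r _ 2)// ?nnegrE ?nrm_ge0 ?addr_ge0 ?nrm_ge0//.
have := form_cauchy_schwarz x y.
rewrite nrm_sqr formDl !formDr -!nrm_sqr [B y x](formC BU); nra.
Qed.

Lemma nrmZ a x : nrm (a *: x) = `|a| * nrm x.
Proof. by rewrite !nrmE formZl formZr mulrA -expr2 sqrtrM ?sqr_ge0// sqrtr_sqr. Qed.

Lemma nrmN x : nrm (- x) = nrm x.
Proof. by rewrite -scaleN1r nrmZ normrN1 mul1r. Qed.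

Lemma nrmB x y : nrm (x - y) <= nrm x + nrm y.
Proof. by rewrite (le_trans (nrmD _ _))// nrmN. Qed.

Lemma nrm_le_sub x y : nrm x <= nrm (x - y) + nrm y.
Proof. by rewrite -{1}(subrK y x) nrmD. Qed.

Lemma nrm0 : nrm 0 = 0.
Proof. by rewrite -(scale0r 0) nrmZ normr0 mul0r. Qed.

Lemma nrm_mean (I : Type) (r : seq I) (P : pred I) (x : I -> V) n (C : R) :
  0 <= C -> count P r = n -> (forall i, P i -> nrm (x i) <= C) ->
  nrm (n%:R^-1 *: \sum_(i <- r | P i) x i) <= C.
Proof.
move=> C0 rn xC; rewrite nrmZ ger0_norm ?invr_ge0//.
have h : nrm (\sum_(i <- r | P i) x i) <= C *+ n.
  rewrite -rn -sum1_count -sumrMnr.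
  elim/big_ind2 : _ => [|a b c d ab cd|i /xC//]; first by rewrite nrm0.
  by rewrite (le_trans (nrmD _ _)) ?lerD.
have [->|n0] := eqVneq n 0%N; first by rewrite invr0 mul0r.
rewrite ler_pdivrMl ?ltr0n ?lt0n//; by rewrite mulr_natl.
Qed.

Lemma nrm_avg N (x : nat -> V) (C : R) : 0 <= C ->
  (forall n, nrm (x n) <= C) -> nrm (avg N x) <= C.
Proof.
by move=> C0 xC; apply: nrm_mean => //; rewrite -sum1_count big_const_ord iter_addn_0 mul1n.
Qed.

Lemma avgB N x y : avg N (fun n => x n - y n : V) = avg N x - avg N y.
Proof. by rewrite /avg big_split/= sumrN scalerBr. Qed.

Lemma nrm_avg_shift N h (x : nat -> V) (C : R) : (forall n, nrm (x n) <= C) ->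
  nrm (avg N x - avg N (fun n => x (n + h)%N)) <= (2 * C * h%:R) / N%:R.
Proof.
move=> xC; elim: h => [|h IH].
  rewrite mulr0 mul0r -avgB /avg big1 ?scaler0 ?nrm0// => i _.
  by rewrite addn0 subrr.
rewrite (le_trans (y := nrm ((avg N x - avg N (fun n => x (n + h)%N)) +
   (avg N (fun n => x (n + h)%N) - avg N (fun n => x (n + h.+1)%N)))))//.
  by rewrite addrA subrK.
rewrite (le_trans (nrmD _ _))// -[h.+1%:R]natr1 mulrDr mulrDl lerD// {IH}.
rewrite /avg -scalerBr nrmZ ger0_norm ?invr_ge0// mulrC ler_wpM2r ?invr_ge0//.
rewrite -sumrB mulr1.
under eq_bigr do rewrite addnS.
(* A unit shift telescopes, leaving two boundary terms. *)
rewrite (_ : \sum_(i < N) _ = x h - x (N + h)%N); last first.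
  elim: N => [|N IH]; first by rewrite big_ord0 add0n subrr.
  by rewrite big_ord_recr/= IH addrA subrK addSn.
by rewrite (le_trans (nrmB _ _))// [leRHS]mulr_natl mulr2n lerD.
Qed.

(** * Averages along lists of group elements *)

Lemma actZD u a x y : U u (a *: x + y) = a *: U u x + U u y.
Proof. exact: (act_linear BU). Qed.

Lemma act_add u x y : U u (x + y) = U u x + U u y.
Proof. by rewrite -{1}[x]scale1r actZD scale1r. Qed.

Lemma act_vec0 u : U u 0 = 0.
Proof. by apply: (addrI (U u 0)); rewrite -act_add !addr0. Qed.

Lemma actZ u a x : U u (a *: x) = a *: U u x.
Proof. by rewrite -[a *: x]addr0 actZD act_vec0 addr0. Qed.

Lemma act_sub u x y : U u (x - y) = U u x - U u y.
Proof. by rewrite act_add -[- y]scaleN1r actZ scaleN1r. Qed.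

Lemma act_sum (I : Type) (r : seq I) (P : pred I) (x : I -> V) u :
  U u (\sum_(i <- r | P i) x i) = \sum_(i <- r | P i) U u (x i).
Proof. by apply: (big_morph (U u) _ (act_vec0 u)) => a b; exact: act_add. Qed.

Lemma nrm_act u x : nrm (U u x) = nrm x.
Proof. by rewrite !nrmE (act_isometry BU). Qed.

Lemma actAC u v x : U u (U v x) = U v (U u x).
Proof. by rewrite -!(actD BU) addrC. Qed.

Lemma act_savg u s f : U u (savg s f) = savg s (U u f).
Proof. by rewrite actZ act_sum; congr (_ *: _); apply: eq_bigr => v _; rewrite actAC. Qed.

Lemma savgD s f g : savg s (f + g) = savg s f + savg s g.
Proof.
by rewrite !savgE -scalerDr -big_split/=; congr (_ *: _); apply: eq_bigr => v _; rewrite act_add.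
Qed.

Lemma savgZ s a f : savg s (a *: f) = a *: savg s f.
Proof.
rewrite !savgE scalerA mulrC -scalerA [a *: \sum_(_ <- _) _]scaler_sumr; congr (_ *: _).
by apply: eq_bigr => v _; rewrite actZ.
Qed.

Lemma nrm_savg s f : nrm (savg s f) <= nrm f.
Proof.
apply: nrm_mean; rewrite ?nrm_ge0 ?count_predT// => v _.
by rewrite nrm_act.
Qed.

Lemma savg_comp s t f : savg s (savg t f) = savg [seq u + v | u <- s, v <- t] f.
Proof.
rewrite [LHS]savgE [RHS]savgE size_allpairs natrM invfM -scalerA big_allpairs_dep/=.
congr (_ *: _); rewrite [RHS]scaler_sumr; apply: eq_bigr => u _.
by rewrite savgE actZ act_sum; congr (_ *: _); apply: eq_bigr => v _; rewrite (actD BU).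
Qed.

Lemma savg_sum (I : Type) (r : seq I) (P : pred I) (x : I -> V) s :
  savg s (\sum_(i <- r | P i) x i) = \sum_(i <- r | P i) savg s (x i).
Proof.
apply: (big_morph (savg s)) => [a b|]; first exact: savgD.
by rewrite -(scale0r 0) savgZ !scale0r.
Qed.

Lemma savgC s t f : savg s (savg t f) = savg t (savg s f).
Proof.
rewrite [LHS]savgE (savgE s f) [RHS]savgZ savg_sum; congr (_ *: _).
by apply: eq_bigr => v _; rewrite act_savg.
Qed.

(** * Vectors averaging to 0 along a subgroup *)

Lemma subgroupN (L : set G) u : subgroup L -> L u -> L (- u).
Proof. by move=> [L0 LB] Lu; rewrite -sub0r; exact: LB. Qed.

Lemma subgroupD (L : set G) u v : subgroup L -> L u -> L v -> L (u + v).
Proof.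
by move=> gL Lu Lv; rewrite -[v]opprK; apply: gL.2 => //; exact: subgroupN.
Qed.

Lemma subgroupMn (L : set G) u n : subgroup L -> L u -> L (u *+ n).
Proof.
move=> gL Lu; elim: n => [|n IH]; first by rewrite mulr0n; exact: gL.1.
by rewrite mulrS; exact: subgroupD.
Qed.

Lemma drawn_from_allpairs (L : set G) s t : subgroup L -> drawn_from L s -> drawn_from L t ->
  drawn_from L [seq u + v | u <- s, v <- t].
Proof.
move=> gL [s0 sL] [t0 tL]; split; first by rewrite size_allpairs muln_gt0 s0.
by move=> _ /allpairsP[[u v] [/sL Lu /tL Lv ->]]; exact: subgroupD.
Qed.

Lemma drawn_from_sub (L L' : set G) s : L `<=` L' -> drawn_from L s -> drawn_from L' s.
Proof. by move=> LL' [s0 sL]; split => // v /sL/LL'. Qed.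

Lemma null_sub_group (L L' : set G) f : L `<=` L' -> null L f -> null L' f.
Proof.
move=> LL' nf tau tau0; have [s [sL fs]] := nf _ tau0.
by exists s; split => //; exact: drawn_from_sub sL.
Qed.

(** Averaging along all sums of elements of the two lists composes the two averages; these commute
    and do not increase the norm, so both summands become small. *)
Lemma nullD L f g : subgroup L -> null L f -> null L g -> null L (f + g).
Proof.
move=> gL nf ng tau tau0; have tau20 : 0 < tau / 2 by rewrite divr_gt0.
have [s [sL fs]] := nf _ tau20; have [t [tL gt]] := ng _ tau20.
exists [seq u + v | u <- s, v <- t]; split; first exact: drawn_from_allpairs.
rewrite -savg_comp savgD savgD (le_trans (nrmD _ _))// [tau]splitr lerD//.
  by rewrite savgC (le_trans (nrm_savg _ _)).
by rewrite (le_trans (nrm_savg _ _)).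
Qed.

Lemma nullZ L a f : null L f -> null L (a *: f).
Proof.
move=> nf tau tau0; have a0 : 0 < `|a| + 1 by rewrite ltr_wpDl.
have [s [sL fs]] := nf _ (divr_gt0 tau0 a0); exists s; split => //.
rewrite savgZ nrmZ (le_trans (ler_wpM2l _ fs))//.
rewrite mulrA ler_pdivrMr// mulrC ler_pM2l//; lra.
Qed.

Lemma null0 L : subgroup L -> null L 0.
Proof.
move=> gL tau tau0; exists [:: 0]; split; last first.
  by rewrite -(scale0r 0) savgZ scale0r nrm0 ltW.
by split => // v; rewrite inE => /eqP ->; exact: gL.1.
Qed.

Lemma null_sum (I : eqType) (r : seq I) (x : I -> V) L : subgroup L ->
  (forall i, i \in r -> null L (x i)) -> null L (\sum_(i <- r) x i).
Proof.
move=> gL xL; rewrite big_seq; elim/big_ind : _ => [|f g|]; first exact: null0.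
  exact: nullD.
exact: xL.
Qed.

Lemma null_act L v f : null L f -> null L (U v f).
Proof.
move=> nf tau tau0; have [s [sL fs]] := nf _ tau0; exists s; split => //.
by rewrite -act_savg nrm_act.
Qed.

Lemma null_savg L s f : subgroup L -> null L f -> null L (savg s f).
Proof.
by move=> gL nf; apply: nullZ; apply: null_sum => // v _; exact: null_act.
Qed.

Lemma null_coboundary L v f : subgroup L -> L v -> null L (U v f - f).
Proof.
move=> gL Lv tau tau0.
(* Along the multiples [v *+ i], [i < n], the average telescopes to [(U (v *+ n) f - f) / n], of
   norm at most [2 * nrm f / n]. *)
pose n := (Num.truncn (2 * nrm f / tau)).+1.
exists [seq v *+ i | i <- iota 0 n]; split.
  split; first by rewrite size_map size_iota.
  by move=> _ /mapP[i _ ->]; exact: subgroupMn.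
rewrite savgE size_map size_iota big_map.
rewrite (_ : \sum_(i <- _) _ = U (v *+ n) f - f).
  rewrite nrmZ ger0_norm ?invr_ge0// ler_pdivrMl ?ltr0Sn//.
  rewrite (le_trans (nrmB _ _))// nrm_act.
  have : 2 * nrm f / tau <= n%:R by rewrite ltW// truncnS_gt.
  rewrite ler_pdivrMr//; lra.
have -> : iota 0 n = index_iota 0 n by rewrite /index_iota subn0.
rewrite big_mkord; elim: n => [|m IH].
  by rewrite big_ord0 mulr0n (act0 BU) subrr.
by rewrite big_ord_recr/= IH act_sub -(actD BU) -mulrSr addrC addrA subrK.
Qed.

Lemma null_sub_savg L s f : subgroup L -> drawn_from L s -> null L (f - savg s f).
Proof.
move=> gL [s0 sL].
(* The difference is a combination of coboundaries. *)
have -> : f - savg s f = - (size s)%:R^-1 *: \sum_(v <- s) (U v f - f).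
  rewrite sumrB scaleNr scalerBr opprB savgE big_const_seq count_predT iter_addr_0.
  by rewrite -[f *+ _]scaler_nat scalerA mulVf ?scale1r// pnatr_eq0 -lt0n.
by apply: nullZ; apply: null_sum => // v /sL; exact: null_coboundary.
Qed.

(* The average of nearly minimal norm is nearly invariant by the parallelogram law,
   since its midpoint with a translate is again an average. *)
Lemma almost_minimal_savg L f (tau : R) : subgroup L -> 0 < tau ->
  exists s, [/\ drawn_from L s,
    forall t, drawn_from L t -> B (savg s f) (savg s f) <= B (savg t f) (savg t f) + tau &
    forall v, L v -> nrm (U v (savg s f) - savg s f) <= tau].
Proof.
move=> gL tau0.
pose E := [set B (savg t f) (savg t f) | t in [set t | drawn_from L t]].
have E0 : has_inf E.
  split; last by exists 0 => _ [t _ <-]; exact: (form_ge0 BU).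
  exists (B (savg [:: 0] f) (savg [:: 0] f)), [:: 0] => //; split => // v.
  by rewrite inE => /eqP ->; exact: gL.1.
(* With [g] within [k] of the infimum of the squared norms, the parallelogram law bounds the square
   of [nrm (U v g - g)] by [4 * k], whence [tau ^+ 2 / 4]. *)
pose k := Num.min tau (tau ^+ 2 / 4).
have k0 : 0 < k by rewrite lt_min tau0 divr_gt0// exprn_gt0.
have [_ [s sL <-] sk] := inf_adherent k0 E0.
have infE t : drawn_from L t -> inf E <= B (savg t f) (savg t f).
  by move=> tL; apply: ge_inf; [exact: E0.2|exists t].
have kt : k <= tau by rewrite ge_min lexx.
have kt2 : k <= tau ^+ 2 / 4 by rewrite ge_min lexx orbT.
exists s; split => //.
  by move=> t /infE; lra.
move=> v Lv; set g := savg s f.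
have := infE (s ++ map (+%R v) s).
have -> : savg (s ++ map (+%R v) s) f = 2^-1 *: g + 2^-1 *: U v g.
  rewrite /g savgE size_cat size_map addnn -muln2 natrM invfM mulrC -scalerA.
  rewrite big_cat/= big_map scalerDr scalerDr savgE actZ act_sum.
  by congr (_ *: _ + _ *: (_ *: _)); apply: eq_bigr => u _; rewrite (actD BU).
rewrite form_sqrD (act_isometry BU) => h.
rewrite -(@ler_pXn2r _ 2)// ?nnegrE ?nrm_ge0 ?(ltW tau0)// nrm_sqr.
have -> : U v g - g = (-1) *: g + 1 *: U v g by rewrite scale1r scaleN1r addrC.
rewrite form_sqrD (act_isometry BU).
have {}h : inf E <= 2^-1 ^+ 2 * B g g + 2 * (2^-1 * 2^-1) * B g (U v g) + 2^-1 ^+ 2 * B g g.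
  apply: h; split; first by rewrite size_cat ltn_addr// sL.1.
  move=> u; rewrite mem_cat => /orP[/sL.2//|/mapP[w /sL.2 Lw ->]].
  exact: subgroupD.
rewrite -/g in sk; move: h sk kt2; rewrite !expr2; lra.
Qed.

(** With [z] the average, [B z z] is the mean of the [B (y n) z], and each of these is at most half
    of [B (y n) (y n) + B z z]. *)
Lemma nrm_avg_jensen N (y : nat -> V) :
  B (avg N y) (avg N y) <= N%:R^-1 * \sum_(n < N) B (y n) (y n).
Proof.
have [->|N0] := eqVneq N 0%N; first by rewrite /avg invr0 scale0r form0l mul0r.
set z := avg N y.
have : B z z = N%:R^-1 * \sum_(n < N) B (y n) z by rewrite {1}/z formZl form_suml.
have : \sum_(n < N) B (y n) z <= \sum_(n < N) (2^-1 * B (y n) (y n) + 2^-1 * B z z).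
  by apply: ler_sum => i _; have := form_AMGM (y i) z; lra.
rewrite big_split/= -!mulr_sumr sumr_const card_ord.
have Np : 0 < N%:R^-1 :> R by rewrite invr_gt0 ltr0n lt0n.
rewrite -(ler_pM2l Np) => h1 h2; move: h1; rewrite -h2 !mulrDr.
rewrite -[B z z *+ N]mulr_natl [_ * (2^-1 * (N%:R * _))]mulrCA (mulrA N%:R^-1 N%:R) mulVf ?pnatr_eq0//.
rewrite (mulrCA N%:R^-1); lra.
Qed.

(** Replacing [x] by its means [y] over blocks of length [H] changes the average by a boundary error
    of order [H / N]. By Jensen, the squared norm of the average of [y] is at most the mean of the
    [H ^ 2] correlations [c N h k]; the diagonal contributes at most [1 / H], the rest at most
    [eta]. *)
Lemma van_der_corput (x : nat -> V) H (eta : R) : (0 < H)%N -> 0 <= eta ->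
  (forall n, nrm (x n) <= 1) ->
  (forall h k, (0 < k)%N -> (h + k < H)%N -> \forall N \near \oo,
     N%:R^-1 * \sum_(n < N) B (x (n + h + k)%N) (x (n + h)%N) <= eta) ->
  forall tau : R, 0 < tau ->
  \forall N \near \oo, nrm (avg N x) <= Num.sqrt (H%:R^-1 + eta) + tau.
Proof.
move=> H0 eta0 x1 corr tau tau0.
pose y n := H%:R^-1 *: \sum_(h < H) x (n + h)%N.
pose c N (h k : nat) := N%:R^-1 * \sum_(n < N) B (x (n + h)%N) (x (n + k)%N).
(* Only finitely many pairs occur, so one threshold for [N] serves them all. *)
have corr' : \forall N \near \oo, forall hk : 'I_H * 'I_H,
    (hk.1 < hk.2)%N -> c N hk.2 hk.1 <= eta.
  apply: filter_forall => -[h k]/=; have [hk|kh] := ltnP h k; last by near=> N.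
  have := corr h (k - h)%N; rewrite subn_gt0 (subnKC (ltnW hk)) => /(_ hk (ltn_ord k)).
  apply: filterS => N + _; congr (_ * _ <= _); apply: eq_bigr => n _.
  by rewrite -addnA (subnKC (ltnW hk)).
near=> N.
have N0 : (0 < N)%N by near: N; exists 1%N.
have cN (h k : 'I_H) : c N h k <= (h == k)%:R + eta.
  have corrN : forall hk : 'I_H * 'I_H, (hk.1 < hk.2)%N -> c N hk.2 hk.1 <= eta by near: N.
  have cC a b : c N a b = c N b a.
    by congr (_ * _); apply: eq_bigr => n _; rewrite (formC BU).
  have := ltngtP h k => -[hk|kh|/val_inj ->].
  - by rewrite cC (le_trans (corrN (h, k) hk))// lerDr.
  - by rewrite (le_trans (corrN (k, h) kh))// lerDr.
  - rewrite eqxx ler_wpDr// /c ler_pdivrMl ?ltr0n// mulr1.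
    have -> : N%:R = \sum_(n < N) 1 :> R by rewrite sumr_const card_ord.
    apply: ler_sum => n _.
    by rewrite -nrm_sqr -(expr1n _ 2) lerXn2r// ?nnegrE ?nrm_ge0.
have yN : nrm (avg N y) <= Num.sqrt (H%:R^-1 + eta).
  rewrite ler_sqrt ?addr_ge0// ?invr_ge0// (le_trans (nrm_avg_jensen _ _))//.
  have -> : N%:R^-1 * \sum_(n < N) B (y n) (y n) =
      H%:R ^- 2 * \sum_(h < H) \sum_(k < H) c N h k.
    have yE n : B (y n) (y n) = H%:R ^- 2 *
        \sum_(h < H) \sum_(k < H) B (x (n + h)%N) (x (n + k)%N).
      rewrite formZl formZr mulrA -expr2 exprVn form_suml.
      by congr (_ * _); apply: eq_bigr => h _; exact: form_sumr.
    under eq_bigr do rewrite yE.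
    rewrite -mulr_sumr mulrCA exchange_big mulr_sumr/=; congr (_ * _).
    by apply: eq_bigr => h _; rewrite exchange_big mulr_sumr.
  rewrite ler_pdivrMl ?exprn_gt0 ?ltr0n// mulrDr.
  have -> : H%:R ^+ 2 / H%:R + H%:R ^+ 2 * eta =
      \sum_(h < H) \sum_(k < H) ((h == k)%:R + eta) :> R.
    under eq_bigr => h _.
      rewrite big_split/= (bigD1 h)//= eqxx big1 ?addr0; last first.
        by move=> k /negPf; rewrite eq_sym => ->.
      rewrite sumr_const card_ord; over.
    rewrite sumr_const card_ord expr2 mulfK ?pnatr_eq0 -?lt0n//.
    by rewrite mulrnDl -mulrA !mulr_natl.
  by apply: ler_sum => h _; apply: ler_sum => k _; exact: cN.
rewrite (le_trans (nrm_le_sub _ (avg N y)))// addrC lerD//.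
have -> : avg N x - avg N y =
    H%:R^-1 *: \sum_(h < H) (avg N x - avg N (fun n => x (n + h)%N)).
  rewrite sumrB scalerBr sumr_const card_ord -[avg N x *+ _]scaler_nat scalerA.
  rewrite mulVf ?scale1r ?pnatr_eq0 -?lt0n//; congr (_ - _).
  rewrite /avg /y -!scaler_sumr scalerA mulrC -scalerA.
  by congr (_ *: (_ *: _)); rewrite exchange_big.
have tN : 2 * H%:R / tau <= N%:R by near: N; exact: nbhs_infty_ger.
have N0' : 0 < N%:R :> R by rewrite ltr0n.
apply: nrm_mean; first exact: ltW.
  by rewrite -sum1_count big_const_ord iter_addn_0 mul1n.
move=> h _; rewrite (le_trans (nrm_avg_shift N h x1))//.
rewrite ler_pdivrMr// mulr1 (@le_trans _ _ (2 * H%:R))//.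
  by rewrite ler_pM2l// ler_nat ltnW.
by rewrite [tau * _]mulrC -ler_pdivrMr.
Unshelve. all: by end_near. Qed.

End IsometricAction.

(** * Polynomial averages *)

Section GroupValuedPolynomials.
Variable G : zmodType.
Implicit Types (c : nat -> G) (L : set G).

Definition zpoly c (D m : nat) : G := \sum_(j < D.+1) c j *+ (m ^ j)%N.

(** The group generated by the [q c_j], [a <= j < b]. Starting at 1 drops the constant term,
    starting at 2 also the linear one. *)
Definition lattice (q : nat) c (a b : nat) : set G :=
  [set v | exists k : nat -> int, v = \sum_(a <= j < b) c j *~ (q%:Z * k j)].

(** By the binomial theorem, the coefficients in [m] of [p (m + k) - p m], for [p] of degree [D.+1];
    the condition [i < j] removes [p m]. *)
Definition diff_coef c (D k i : nat) : G :=
  \sum_(j < D.+2 | (i < j)%N) c j *+ ('C(j, i) * k ^ (j - i)).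

Lemma subgroupMz L u (z : int) : subgroup L -> L u -> L (u *~ z).
Proof.
move=> gL Lu; case: z => n; first exact: subgroupMn.
by rewrite NegzE mulrNz; apply: subgroupN => //; exact: subgroupMn.
Qed.

Lemma subgroup_sum (I : Type) (r : seq I) (P : pred I) (F : I -> G) L :
  subgroup L -> (forall i, P i -> L (F i)) -> L (\sum_(i <- r | P i) F i).
Proof.
move=> gL FL; elim/big_ind : _ => //; first exact: gL.1.
by move=> u v; exact: subgroupD.
Qed.

Lemma lattice_subgroup q c a b : subgroup (lattice q c a b).
Proof.
split; first by exists (fun=> 0); rewrite big1// => j _; rewrite mulr0 mulr0z.
move=> _ _ [k ->] [l ->]; exists (fun j => k j - l j).
by rewrite -sumrB; apply: eq_bigr => j _; rewrite mulrBr mulrzBr.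
Qed.

Lemma lattice_gen q c a b j (z : int) : (a <= j < b)%N ->
  lattice q c a b (c j *~ (q%:Z * z)).
Proof.
move=> ajb; exists (fun i => if i == j then z else 0).
rewrite (bigD1_seq j) ?iota_uniq ?mem_index_iota//= eqxx big1 ?addr0// => i.
by move=> /negPf ->; rewrite mulr0 mulr0z.
Qed.

Lemma lattice_sub q c a b L : subgroup L ->
  (forall j, (a <= j < b)%N -> L (c j *+ q)) -> lattice q c a b `<=` L.
Proof.
move=> gL cL _ [k ->]; rewrite big_nat; apply: subgroup_sum => // j ajb.
by rewrite mulrzA; apply: subgroupMz => //; exact: cL.
Qed.

Lemma zpoly_shift q c D m a : lattice q c 2 D.+2
  (zpoly c D.+1 (m + q * a) - zpoly c D.+1 m - c 1%N *+ (q * a)).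
Proof.
(* [(m + q a) ^ j] and [m ^ j] agree modulo [q]; the linear term is subtracted exactly, so only
   [j >= 2] remains. *)
have /choice[t tE] j : exists t, ((m + q * a) ^ j = m ^ j + q * t)%N.
  elim: j => [|j [t IH]]; first by exists 0%N; rewrite muln0.
  by exists (a * m ^ j + (m + q * a) * t)%N; rewrite expnS IH expnS; ring.
exists (fun j => (t j)%:Z); rewrite /zpoly -sumrB !big_ord_recl/= !expn0 subrr add0r.
rewrite /bump/= !addn0 !expn1 mulrnDr (addrC (c 1%N *+ m)) addrK addrC addKr.
rewrite [RHS]big_add1 [RHS]big_add1/= big_mkord; apply: eq_bigr => i _.
by rewrite add1n add1n tE mulrnDr (addrC (_ *+ _)) addrK -PoszM.
Qed.

Lemma zpoly_diff c D m k :
  zpoly c D.+1 (m + k) = zpoly c D.+1 m + zpoly (diff_coef c D k) D m.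
Proof.
rewrite /zpoly; under [in X in _ + X]eq_bigr do rewrite -sumrMnl.
rewrite (exchange_big_dep predT)//= -big_split/=; apply: eq_bigr => j _.
rewrite addnC expnDn big_ord_recr/= subnn expn0 mul1n binn mul1n addnC mulrnDr.
congr (_ + _); rewrite -sumrMnr.
rewrite (big_ord_widen_cond D.+1 predT
  (fun i => c j *+ ('C(j, i) * (k ^ (j - i) * m ^ i))))/=; last first.
  by rewrite -ltnS.
by apply: eq_bigr => i _; rewrite -mulrnA mulnA.
Qed.

Lemma lattice_diff_coef q c D k M :
  (forall j, (2 <= j < D.+2)%N -> (j * k %| M)%N) ->
  lattice (q * M ^ D) c 2 D.+2 `<=` lattice q (diff_coef c D k) 1 D.+1.
Proof.
move=> jkM; set L := lattice q _ _ _; have gL : subgroup L by exact: lattice_subgroup.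
(* The system expressing the new coefficients by the old ones is triangular, so it
   is solved from the leading coefficient down, losing a factor [M] at each step. *)
have cL i : forall j, (2 <= j < D.+2)%N -> (D.+2 <= j + i)%N -> L (c j *+ (q * M ^ i)).
  elim: i => [|i IH] j jD ji; first by exfalso; lia.
  have /dvdnP[t tE] := jkM j jD.
  (* The entry of [diff_coef] at [j - 1] is [j k c_j] plus multiples of the [c_l] with [l > j]. As
     [M = t j k], the factor [q M ^ i t] turns its first term into [q M ^ (i + 1) c_j]; the others
     lie in [L] by induction. *)
  have -> : c j *+ (q * M ^ i.+1) = diff_coef c D k j.-1 *~ (q%:Z * (M ^ i * t)%N%:Z)
      - \sum_(l < D.+2 | (j < l)%N) c l *+ (q * M ^ i) *+ ('C(l, j.-1) * k ^ (l - j.-1) * t).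
    have jl : (j < D.+2)%N by lia.
    rewrite -PoszM -[RHS]/(_ *+ _ - _) /diff_coef (bigD1 (Ordinal jl))/=; last by lia.
    rewrite (eq_bigl (fun l : 'I_D.+2 => (j < l)%N)); last first.
      by move=> l; rewrite -(inj_eq val_inj)/=; lia.
    rewrite mulrnDl -sumrMnl.
    rewrite [X in _ = _ + X - _](_ : _ = \sum_(l < D.+2 | (j < l)%N)
       c l *+ (q * M ^ i) *+ ('C(l, j.-1) * k ^ (l - j.-1) * t)).
      rewrite addrK -mulrnA; congr (_ *+ _); rewrite expnS tE.
      have -> : 'C(j, j.-1) = j by case: (j) jD => // i' _; rewrite binSn.
      have -> : (j - j.-1)%N = 1%N by lia.
      by rewrite expn1; ring.
    by apply: eq_bigr => l _; rewrite -!mulrnA; congr (_ *+ _); ring.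
  apply: gL.2; first by apply: lattice_gen; lia.
  apply: subgroup_sum => // l jl; apply: subgroupMn => //.
  have lD := ltn_ord l.
  by apply: IH; lia.
(* Since [j >= 2], exponent [D] suffices for every [j]. *)
by apply: lattice_sub => // j jD; apply: cL => //; lia.
Qed.

End GroupValuedPolynomials.

Section NearlyInvariant.
Variables (R : realType) (V : lmodType R) (G : zmodType).
Variables (B : V -> V -> R) (U : G -> V -> V).
Hypothesis BU : isometric_action B U.

(* Modulo the near-invariance, shifting the argument of the polynomial by multiples
   of [q] acts as [c 1], so the polynomial average is dominated by linear ones. *)
Lemma nrm_avg_almost_invariant (c : nat -> G) D q s f (tau : R) : 0 < tau ->
  nrm B f <= 1 ->
  (forall v, lattice q c 2 D.+2 v -> nrm B (U v f - f) <= tau) ->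
  null B U (lattice q c 1 D.+2) f ->
  \forall N \near \oo,
    nrm B (avg N (fun n => U (zpoly c D.+1 (n + s)) f)) <= 3 * tau.
Proof.
move=> tau0 f1 finv nf; have [t [[t0 tL] ft]] := nf _ tau0.
pose L2 := lattice q c 2 D.+2; have gL2 : subgroup L2 by exact: lattice_subgroup.
(* Modulo [L2], each [v] in the list is the multiple [q * m v] of [c 1]. *)
have /choice[m mP] v : exists m : int, v \in t -> L2 (v - c 1%N *~ (q%:Z * m)).
  have [vt|vt] := boolP (v \in t); last by exists 0.
  have [k vE] := tL _ vt; exists (k 1%N) => _.
  by exists k; rewrite vE big_ltn// addrC addKr.
(* Arguments of the polynomial are shifted by natural numbers only, so all [m v] are raised by [M];
   the translation [w] accounts for this. *)
pose M := (\sum_(v <- t) `|m v|)%N.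
have mM v : v \in t -> (`|m v| <= M)%N.
  by move=> vt; rewrite /M (big_rem v)//= leq_addr.
pose a v := absz (m v + M%:Z).
have aE v : v \in t -> (a v)%:Z = m v + M%:Z by move=> /mM; rewrite /a; lia.
have aM v : v \in t -> (a v <= 2 * M)%N by move=> /mM; rewrite /a; lia.
pose w := c 1%N *+ (q * M).
pose x n := U (zpoly c D.+1 (n + s)) f.
have x1 n : nrm B (x n) <= 1 by rewrite (nrm_act BU).
have xa v n : v \in t ->
    nrm B (x (n + q * a v)%N - U (zpoly c D.+1 (n + s) + w + v) f) <= tau.
  move=> vt; rewrite -(nrm_act BU (- (zpoly c D.+1 (n + s) + w + v))).
  rewrite (act_sub BU) -!(actD BU) addNr (act0 BU); apply: finv.
  have := zpoly_shift q c D (n + s) (a v); rewrite addnAC => h.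
  have -> : - (zpoly c D.+1 (n + s) + w + v) + zpoly c D.+1 (n + q * a v + s) =
    (zpoly c D.+1 (n + q * a v + s) - zpoly c D.+1 (n + s) - c 1%N *+ (q * a v))
    - (v - c 1%N *~ (q%:Z * m v)).
    have -> : c 1%N *+ (q * a v) = c 1%N *~ (q%:Z * m v) + w.
      by rewrite pmulrn PoszM aE// mulrDr mulrzDr -PoszM -pmulrn.
    rewrite !opprD opprK !addrA [RHS](ACl (1*2*4*5*(3*6)))/= addNr addr0.
    by rewrite [LHS](ACl (4*1*2*3)).
  by apply: gL2.2 => //; exact: mP.
near=> N.
have N0 : (0 < N%:R :> R) by rewrite ltr0n; near: N; exists 1%N.
have tN : 2 * (q * (2 * M))%:R / tau <= N%:R :> R by near: N; exact: nbhs_infty_ger.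
have t0R : (size t)%:R != 0 :> R by rewrite pnatr_eq0 -lt0n.
(* In [z] the small vector [savg U t f] is translated, so [z] costs [tau]. Passing from [avg N x] to
   [z] costs [tau] for the shifts and [tau] for the near-invariance. *)
pose z := avg N (fun n => U (zpoly c D.+1 (n + s) + w) (savg U t f)).
have zt : nrm B z <= tau.
  by apply: (nrm_avg BU) => [|n]; [exact: ltW|rewrite (nrm_act BU)].
rewrite (le_trans (nrm_le_sub BU _ z))// (_ : 3 * tau = 2 * tau + tau); last by lra.
rewrite lerD//.
have -> : avg N x - z = (size t)%:R^-1 *: \sum_(v <- t)
    (avg N x - avg N (fun n => U (zpoly c D.+1 (n + s) + w + v) f)).
  rewrite sumrB scalerBr big_const_seq count_predT iter_addr_0.
  rewrite -[avg N x *+ _]scaler_nat scalerA mulVf// scale1r; congr (_ - _).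
  rewrite /z /avg -scaler_sumr scalerA mulrC -scalerA exchange_big/=; congr (_ *: _).
  rewrite scaler_sumr; apply: eq_bigr => n _.
  rewrite (actZ BU) (act_sum BU); congr (_ *: _).
  by apply: eq_bigr => v _; rewrite -(actD BU).
rewrite big_seq; apply: (nrm_mean BU); first by rewrite mulr_ge0// ltW.
  by apply/eqP; rewrite -all_count; apply/allP.
move=> v vt; rewrite -(subrK (avg N (fun n => x (n + q * a v)%N)) (avg N x)) -addrA.
rewrite (le_trans (nrmD BU _ _))// [leRHS]mulr_natl mulr2n lerD//; last first.
  by rewrite -avgB; apply: (nrm_avg BU) => [|n]; [exact: ltW|exact: xa].
rewrite (le_trans (nrm_avg_shift BU N _ x1))// mulr1 ler_pdivrMr//.
rewrite (@le_trans _ _ (2 * (q * (2 * M))%:R))//.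
  by rewrite ler_pM2l// ler_nat leq_mul2l aM ?orbT.
by rewrite [tau * _]mulrC -ler_pdivrMr.
Unshelve. all: by end_near. Qed.

End NearlyInvariant.

(** As [q] precedes the coefficients, the induction hypothesis applies to all difference polynomials
    at once; [s] absorbs the shifts that van der Corput's inequality introduces. *)
Theorem polynomial_mean_ergodic (R : realType) (D : nat) (eps : R) : 0 < eps ->
  exists q : nat, (0 < q)%N /\
  forall (V : lmodType R) (G : zmodType) (B : V -> V -> R) (U : G -> V -> V),
    isometric_action B U ->
  forall (c : nat -> G) (s : nat) (f : V), nrm B f <= 1 ->
    null B U (lattice q c 1 D.+1) f ->
  \forall N \near \oo, nrm B (avg N (fun n => U (zpoly c D (n + s)) f)) <= eps.
Proof.
elim: D eps => [|D IH] eps eps0.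
  exists 1%N; split => // V G B U BU c s f _ nf; near=> N.
  apply: (nrm_avg BU) => [|n]; first exact: ltW.
  (* In degree 0 the lattice is trivial, so every average of [f] is [f] itself, which is therefore
     small. *)
  rewrite (nrm_act BU); have [t [[t0 tL] ft]] := nf _ eps0.
  rewrite (le_trans _ ft)// /savg big_seq.
  rewrite (eq_bigr (fun=> f)); last first.
    by move=> v /tL [k ->]; rewrite big_geq// (act0 BU).
  rewrite -big_seq big_const_seq count_predT iter_addr_0.
  by rewrite -[f *+ _]scaler_nat scalerA mulVf ?scale1r// pnatr_eq0 -lt0n.
(* The final bound is [2 * (e + e) + 3 * e = 7 * e]: twice the van der Corput bound for [g], where
   [H^-1 + eta <= e ^+ 2], plus the bound for [f']. *)
pose e := eps / 8; have e0 : 0 < e by rewrite divr_gt0.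
pose eta := e ^+ 2 / 2; have eta0 : 0 < eta by rewrite divr_gt0// exprn_gt0.
have [q1 [q10 Hq1]] := IH _ eta0.
pose H := (Num.truncn eta^-1).+1.
have H0 : H%:R^-1 <= eta by rewrite invf_ple ?posrE// ltW// truncnS_gt.
(* A common multiple of all [j * k] with [2 <= j <= D.+1] and [0 < k < H]. *)
pose M := (D.+1`! * H`!)%N.
have M0 : (0 < M)%N by rewrite muln_gt0 !fact_gt0.
exists (q1 * M ^ D)%N; split; first by rewrite muln_gt0 q10 expn_gt0 M0.
move=> V G B U BU c s f f1 nf; set q := (q1 * M ^ D)%N in nf.
pose L2 := lattice q c 2 D.+2; have gL2 : subgroup L2 by exact: lattice_subgroup.
have [t [tL2 _ tinv]] := almost_minimal_savg BU f gL2 e0.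
(* Halving keeps [g] in the unit ball, as the induction hypothesis requires. *)
pose f' := savg U t f; pose g := 2^-1 *: (f - f').
have f'1 : nrm B f' <= 1 by rewrite (le_trans (nrm_savg BU _ _)).
have g1 : nrm B g <= 1.
  rewrite (nrmZ BU) ger0_norm ?invr_ge0// ler_pdivrMl// mulr1.
  by rewrite (le_trans (nrmB BU _ _))// (_ : 2 = 1 + 1)// lerD.
have ng : null B U L2 g by apply: (nullZ BU); exact: null_sub_savg.
have nf' : null B U (lattice q c 1 D.+2) f'.
  by apply: (null_savg BU) => //; exact: lattice_subgroup.
have avgf' := nrm_avg_almost_invariant BU s e0 f'1 tinv nf'.
have avgg := @van_der_corput _ _ _ _ _ BU (fun n => U (zpoly c D.+1 (n + s)) g) H eta.
have {}avgg : \forall N \near \oo, nrm B (avg N (fun n => U (zpoly c D.+1 (n + s)) g))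
    <= Num.sqrt (H%:R^-1 + eta) + e.
  apply: avgg => //; first exact: ltW.
    by move=> n; rewrite (nrm_act BU).
  move=> h k k0 hk.
  have kM j : (2 <= j < D.+2)%N -> (j * k %| M)%N.
    by move=> jD; apply: dvdn_mul; apply: dvdn_fact; lia.
  have ngk := null_sub_group (lattice_diff_coef kM) ng.
  have := Hq1 _ _ _ _ BU _ (s + h)%N _ g1 ngk; apply: filterS => N hN.
  (* By isometry the correlation depends only on the difference [p (n + k) - p n], a polynomial of
     degree at most [D]. *)
  rewrite (_ : _ * _ = B (avg N (fun n => U (zpoly (diff_coef c D k) D (n + (s + h))) g)) g).
    rewrite (le_trans (form_cauchy_schwarz BU _ _))// -[leRHS]mulr1.
    by rewrite ler_pM ?nrm_ge0.
  rewrite /avg (formZl BU) (form_suml BU); congr (_ * _); apply: eq_bigr => n _.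
  have -> : (n + h + k + s = (n + (s + h)) + k)%N by lia.
  have -> : (n + h + s = n + (s + h))%N by lia.
  by rewrite zpoly_diff (actD BU) (act_isometry BU).
near=> N.
have -> : avg N (fun n => U (zpoly c D.+1 (n + s)) f) =
    2 *: avg N (fun n => U (zpoly c D.+1 (n + s)) g) +
    avg N (fun n => U (zpoly c D.+1 (n + s)) f').
  rewrite /avg scalerA mulrC -scalerA [2 *: \sum_(_ < _) _]scaler_sumr -scalerDr -big_split/=.
  congr (_ *: _); apply: eq_bigr => n _.
  by rewrite -(actZ BU) -(act_add BU) scalerA divff// scale1r subrK.
rewrite (le_trans (nrmD BU _ _))// (nrmZ BU) ger0_norm//.
have hg : nrm B (avg N (fun n => U (zpoly c D.+1 (n + s)) g))
    <= Num.sqrt (H%:R^-1 + eta) + e by near: N.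
have hf' : nrm B (avg N (fun n => U (zpoly c D.+1 (n + s)) f')) <= 3 * e by near: N.
have he : Num.sqrt (H%:R^-1 + eta) <= e.
  rewrite -[leRHS](ger0_norm (ltW e0)) -sqrtr_sqr ler_sqrt ?sqr_ge0//.
  by move: H0; rewrite /eta; lra.
move: hg hf' he; rewrite /e; lra.
Unshelve. all: by end_near. Qed.

(** * Multiplicative complexity *)

Definition coef_row (r : nat) (P : 'I_r -> {poly int}) (j : nat) : 'rV[int]_r :=
  \row_i (P i)`_j.

Lemma polymap_zpoly D r (P : 'I_r -> {poly int}) (n : nat) :
  (forall i, (size (P i) <= D.+1)%N) ->
  polymap P n%:Z = zpoly (coef_row P) D n.
Proof.
move=> PD; apply/rowP => i; rewrite mxE (horner_coef_wide _ (PD i)) summxE.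
by apply: eq_bigr => j _; rewrite mulmxnE mxE -mulr_natr natrX natz.
Qed.

Lemma dvdn_gcd_family (I : finType) (a : I -> int) i : (gcd_family a %| `|a i|)%N.
Proof. by rewrite /gcd_family (bigD1 i)//= dvdn_gcdl. Qed.

(* The Smith normal form exhibits primitive functionals whose values on the
   coefficients are multiples of the elementary divisors. *)
Lemma mult_complexity_lattice D r Q q (P : 'I_r -> {poly int}) :
  mult_complexity D P Q ->
  forall v : 'rV[int]_r, lattice q (coef_row P) 1 D.+1 (v *+ (q * Q`!)).
Proof.
move=> PQ v; pose C : 'M[int]_(r, D) := \matrix_(i, j) (P i)`_j.+1.
have [L uL [S uS [d _ CE]]] := int_Smith_normal_form C.
(* Rows beyond the [D] columns have no diagonal entry and count as 0. *)
pose e (i : 'I_r) : int := if (i < D)%N then d`_i else 0.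
(* Row [i] of the inverse of [L] is primitive, since its product with column [i] of [L] is 1.
   Applied to [P] it yields row [i] of the diagonal matrix times [S], whose entries are multiples of
   [e i]; the complexity bound with modulus [m] then applies. *)
have dvd_e (i : 'I_r) (m : int) : (m %| e i)%Z -> (`|m| <= Q)%N.
  move=> me; pose a k := invmx L i k.
  have pa : gcd_family a = 1%N.
    suff : ((gcd_family a)%:Z %| 1)%Z by rewrite dvdzE/= dvdn1 => /eqP.
    have -> : 1%:Z = \sum_k invmx L i k * L k i.
      by have := mulVmx uL => /matrixP/(_ i i); rewrite !mxE eqxx => ->.
    by apply: rpred_sum => k _; rewrite dvdz_mulr// dvdzE dvdn_gcd_family.
  have := PQ a m; rewrite pa gcd1n => /(_ erefl)/=; apply: leq_trans.
  have [->//|m0] := eqVneq m 0.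
  rewrite leq_eqVlt; apply/orP; left; rewrite eq_sym; apply/eqP/gcdn_idPr.
  rewrite big_nat; elim/big_ind : _ => [||j /andP[j0 jD]]; first exact: dvdn0.
    by move=> x y mx my; rewrite dvdn_gcd mx.
  have jD' : (j.-1 < D)%N by lia.
  have -> : (\sum_(k < r) a k *: (P k - ((P k)`_0)%:P))`_j =
      \sum_(k < D) d`_i *+ (i == k :> nat) * S k (Ordinal jD').
    transitivity ((invmx L *m C) i (Ordinal jD')).
      rewrite coef_sum mxE; apply: eq_bigr => k _; rewrite !mxE/= prednK//.
      by rewrite coefZ coefB coefC gtn_eqF// subr0.
    rewrite CE mulmxA mulKmx// mxE.
    by apply: eq_bigr => k _; rewrite !mxE.
  rewrite -dvdzE; apply: rpred_sum => k _; rewrite dvdz_mulr//.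
  have [ik|_] := eqVneq (i : nat) k; last by rewrite mulr0n dvdz0.
  by rewrite mulr1n; move: me; rewrite /e ik ltn_ord.
(* Otherwise [Q.+1] would divide [e i]. In particular [r <= D]. *)
have e0 i : e i != 0.
  apply/eqP => ei0; have := dvd_e i Q.+1%:Z; rewrite ei0 dvdz0 => /(_ isT)/=.
  by rewrite ltnn.
have eQ i : (e i %| Q`!%:Z)%Z.
  by rewrite dvdzE/= dvdn_fact// absz_gt0 e0 (dvd_e i).
have iD (i : 'I_r) : (i < D)%N by have := e0 i; rewrite /e; case: ifP; rewrite ?eqxx.
(* As each [e i] divides the factorial of [Q], the diagonal system has an integral solution [u],
   padded with 0 beyond row [r]. *)
pose w := invmx L *m v^T.
pose u : 'cV[int]_D := \col_j (if insub (j : nat) is Some i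
  then (Q`!%:Z %/ e i)%Z * w i 0 else 0).
pose k := invmx S *m u.
have CK : C *m k = Q`!%:Z *: v^T.
  rewrite CE /k -!mulmxA (mulmxA S) mulmxV// mul1mx.
  suff -> : (\matrix_(i, j) (d`_i *+ (i == j :> nat))) *m u = Q`!%:Z *: w.
    by rewrite -scalemxAr /w mulmxA mulmxV// mul1mx.
  apply/colP => i; rewrite !mxE (bigD1 (Ordinal (iD i)))//= big1; last first.
    move=> j ij; rewrite !mxE.
    have /negPf -> : (i : nat) != j by apply: contraNneq ij => ij; apply/eqP/val_inj.
    by rewrite mulr0n mul0r.
  rewrite !mxE/= eqxx mulr1n addr0 valK mulrA; congr (_ * _); last by rewrite mxE.
  have -> : d`_i = e i by rewrite /e iD.
  by rewrite mulrC divzK.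
pose K (j : nat) : int := if (insub j.-1 : option 'I_D) is Some i then k i 0 else 0.
exists K.
rewrite big_add1/= big_mkord; apply/rowP => i.
have ckE : \sum_(j < D) (P i)`_j.+1 * k j 0 = Q`!%:Z * v 0 i.
  have /colP/(_ i) := CK; rewrite mxE [RHS]mxE [v^T _ _]mxE => <-.
  by apply: eq_bigr => j _; rewrite [C _ _]mxE.
have -> : (v *+ (q * Q`!)) 0 i = q%:Z * (Q`!%:Z * v 0 i).
  by rewrite mulmxnE mulrA -PoszM -mulr_natl natz.
rewrite summxE -ckE mulr_sumr; apply: eq_bigr => j _.
rewrite /K/= valK -scaler_int intz [RHS]mxE [coef_row _ _ _ _]mxE; ring.
Qed.

(** * Measure preserving actions *)

Section BoundedMeasurable.
Context d (X : measurableType d) (R : realType).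

(** These functions stand in for the square-integrable classes: they can be evaluated at points, and
    their products are integrable. *)
Definition bounded_measurable : {pred X -> R} :=
  [pred f : X -> R | `[< measurable_fun setT f /\ exists M : R, forall x, `|f x| <= M >]].

Record bmfun := BMFun { bmfun_fun :> X -> R; _ : bmfun_fun \in bounded_measurable }.

HB.instance Definition _ := [isSub for bmfun_fun].
HB.instance Definition _ := [Choice of bmfun by <:].

Lemma bounded_measurableP (f : X -> R) :
  f \in bounded_measurable <-> measurable_fun setT f /\ exists M : R, forall x, `|f x| <= M.
Proof. by rewrite inE. Qed.

Lemma bounded_measurable_submod_closed : submod_closed bounded_measurable.
Proof.
split.
  apply/bounded_measurableP; split; first exact: measurable_cst.
  by exists 0 => x; rewrite normr0.
move=> a f g /bounded_measurableP[mf [M fM]] /bounded_measurableP[mg [K gK]].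
apply/bounded_measurableP; split.
  by apply: measurable_funD => //; exact: measurable_funM.
exists (`|a| * M + K) => x; rewrite (le_trans (ler_normD _ _))// lerD//.
by rewrite normrM ler_wpM2l.
Qed.

HB.instance Definition _ :=
  GRing.isSubmodClosed.Build _ _ bounded_measurable bounded_measurable_submod_closed.
HB.instance Definition _ := [SubChoice_isSubLmodule of bmfun by <:].

Lemma measurable_bmfun (f : bmfun) : measurable_fun setT f.
Proof. by case: f => f /= /bounded_measurableP[]. Qed.

Lemma bounded_bmfun (f : bmfun) : exists M : R, forall x, `|f x| <= M.
Proof. by case: f => f /= /bounded_measurableP[]. Qed.

Lemma bounded_measurable_comp (f : bmfun) (S : X -> X) : measurable_fun setT S ->
  f \o S \in bounded_measurable.
Proof.
move=> mS; apply/bounded_measurableP; split.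
  exact: measurableT_comp (measurable_bmfun f) mS.
by have [M fM] := bounded_bmfun f; exists M => x; exact: fM.
Qed.

Lemma bounded_measurable_cst (a : R) : cst a \in bounded_measurable.
Proof.
by apply/bounded_measurableP; split; [exact: measurable_cst|exists `|a| => x].
Qed.

Lemma bounded_measurable_indic (A : set X) : measurable A -> \1_A \in bounded_measurable.
Proof.
move=> mA; apply/bounded_measurableP; split; first exact: measurable_indic.
by exists 1 => x; rewrite indicE ger0_norm// lern1 leq_b1.
Qed.

Definition bmcst a := BMFun (bounded_measurable_cst a).
Definition bmindic A (mA : measurable A) := BMFun (bounded_measurable_indic mA).

Lemma bmfun_sumE (I : Type) (r : seq I) (P : pred I) (f : I -> bmfun) x :
  (\sum_(i <- r | P i) f i : bmfun) x = \sum_(i <- r | P i) f i x.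
Proof. by elim/big_rec2 : _ => // i y1 y2 _ <-. Qed.

Section Integral.
Variable mu : probability X R.

Lemma integrable_bounded (f : X -> R) (M : R) : measurable_fun setT f ->
  (forall x, `|f x| <= M) -> mu.-integrable setT (EFin \o f).
Proof.
move=> mf fM; apply: measurable_bounded_integrable => //.
  by rewrite (le_lt_trans (probability_le1 _ _))// ltry.
by exists M; split => [|K MK x _ /=]; [exact: num_real|rewrite (le_trans (fM x))// ltW].
Qed.

Lemma integrable_bmfunM (f g : bmfun) : mu.-integrable setT (EFin \o (fun x => f x * g x)).
Proof.
have [M fM] := bounded_bmfun f; have [K gK] := bounded_bmfun g.
apply: (@integrable_bounded _ (M * K)).
  by apply: measurable_funM; exact: measurable_bmfun.
by move=> x; rewrite normrM ler_pM.
Qed.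

Definition L2form (f g : bmfun) : R := \int[mu]_x (f x * g x).

Lemma L2form_le1 (f : bmfun) : (forall x, `|f x| <= 1) -> nrm L2form f <= 1.
Proof.
move=> f1; rewrite -[leRHS]sqrtr1 ler_sqrt//.
have -> : 1 = \int[mu]_x (cst 1 x) :> R.
  by rewrite Rintegral_cst// [X in fine X](probability_setT mu) mulr1.
apply: le_Rintegral => //; first exact: integrable_bmfunM.
  by apply: (@integrable_bounded _ 1) => // x; rewrite normr1.
by move=> x _ /=; rewrite -expr2 -real_normK ?num_real// expr_le1.
Qed.

Lemma Lnorm_bmfun (f : bmfun) : Lnorm mu 2%:E (EFin \o f) = (nrm L2form f)%:E.
Proof.
rewrite unlock /nrm /L2form.
have -> : (\int[mu]_x `|(EFin \o f) x| `^ 2 = (\int[mu]_x (f x * f x))%:E)%E.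
  rewrite /Rintegral fineK; last by apply: integrable_fin_num => //; exact: integrable_bmfunM.
  apply: eq_integral => x _ /=.
  by rewrite powR_mulrn// real_normK ?num_real// expr2.
rewrite poweR_EFin powR12_sqrt//.
by apply: Rintegral_ge0 => x _; rewrite -expr2 sqr_ge0.
Qed.

End Integral.

Section Action.
Variables (mu : probability X R) (r : nat) (T : 'rV[int]_r -> X -> X).
Hypothesis muT : mp_action mu T.

Lemma measurable_action v : measurable_fun setT (T v).
Proof. by case: muT. Qed.

Definition koopman (v : 'rV[int]_r) (f : bmfun) : bmfun :=
  BMFun (bounded_measurable_comp f (measurable_action v)).

Lemma Rintegral_action v (h : X -> R) (M : R) : measurable_fun setT h ->
  (forall x, `|h x| <= M) -> \int[mu]_x h (T v x) = \int[mu]_x h x.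
Proof.
move=> mh hM; have mT := measurable_action v; rewrite /Rintegral; congr fine.
have := @integral_pushforward _ _ _ _ _ (T v) mT mu setT (EFin \o h).
rewrite preimage_setT => <- //.
- apply: eq_measure_integral => A mA _; case: muT => _ _ _ /(_ v A mA).
  exact.
- exact/measurable_EFinP.
- apply: (@integrable_bounded _ _ M); last by move=> x; exact: hM.
  exact: measurableT_comp.
Qed.

Lemma koopman_isometric_action : isometric_action (L2form mu) koopman.
Proof.
have [T0 TD _ _] := muT; split.
- by move=> f g; apply: eq_Rintegral => x _; rewrite mulrC.
- move=> a f g h; rewrite /L2form -RintegralZl//; last exact: integrable_bmfunM.
  rewrite -RintegralD//; last exact: integrable_bmfunM.
    by apply: eq_Rintegral => x _; rewrite mulrDl -mulrA.
  apply: (eq_integrable _ (EFin \o (fun x => (a *: f) x * h x))) => //.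
    by move=> x _ /=; rewrite mulrA.
  exact: integrable_bmfunM.
- by move=> f; apply: Rintegral_ge0 => x _; rewrite -expr2 sqr_ge0.
- by move=> f; apply/val_inj/funext => x /=; rewrite T0.
(* Composition with [T] reverses the order of the factors, which is harmless as the group is
   abelian. *)
- by move=> u v f; apply/val_inj/funext => x /=; rewrite addrC TD.
- by move=> u a f g; apply/val_inj/funext.
- move=> u f g; have [M fM] := bounded_bmfun f; have [K gK] := bounded_bmfun g.
  apply: (@Rintegral_action u (fun x => f x * g x) (M * K)).
    by apply: measurable_funM; exact: measurable_bmfun.
  by move=> x; rewrite normrM ler_pM.
Qed.

End Action.
End BoundedMeasurable.

(** The upper limit is an infimum of suprema over the sets of the filter, and the set where the
    bound holds is one of them. *)
Lemma limn_esup_le_near (R : realType) (u : (\bar R)^nat) (l : \bar R) :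
  (\forall n \near \oo, (u n <= l)%E) -> (limn_esup u <= l)%E.
Proof.
move=> ul; apply: (@le_trans _ _ (ereal_sup (u @` [set n | (u n <= l)%E]))).
  by apply: ereal_inf_lbound; exists [set n | (u n <= l)%E].
by apply: ge_ereal_sup => _ [n /= un <-].
Qed.

(** * Energy of the box averages of an equidistributed set *)

Section Equidistribution.
Context d (X : measurableType d) (R : realType) (mu : probability X R).
Variables (r : nat) (T : 'rV[int]_r -> X -> X).
Hypothesis muT : mp_action mu T.
Local Notation U := (koopman muT).
Local Notation B2 := (L2form mu).

Definition box (q n : nat) : seq 'rV[int]_r :=
  [seq \row_i ((q * (a i).+1)%N%:Z) | a : {ffun 'I_r -> 'I_n}].

Lemma size_box q n : size (box q n) = (n ^ r)%N.
Proof. by rewrite size_map -cardE card_ffun !card_ord. Qed.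

Lemma savg_koopmanE s (f : bmfun X R) x :
  savg U s f x = (size s)%:R^-1 * \sum_(v <- s) f (T v x).
Proof. by rewrite -(bmfun_sumE s xpredT (fun v => U v f)). Qed.

Lemma freq_savg q B (mB : measurable B) x n :
  @freq d X R r T q B x n = savg U (box q n) (bmindic R mB) x.
Proof.
rewrite savg_koopmanE size_box natrX big_map/= big_enum_cond.
by rewrite /freq; congr (_ * _); apply: eq_bigl => a; rewrite inE.
Qed.

Lemma L2form_koopman_cst v f a : B2 (U v f) (bmcst X a) = B2 f (bmcst X a).
Proof.
have -> : bmcst X a = U v (bmcst X a) by exact/val_inj.
by rewrite (act_isometry (koopman_isometric_action muT)).
Qed.

Lemma L2form_indic_cst B (mB : measurable B) :
  B2 (bmindic R mB) (bmcst X 1) = fine (mu B).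
Proof.
rewrite /L2form /Rintegral; congr fine.
under eq_integral do rewrite /= mulr1.
by rewrite integral_indic// setIT.
Qed.

Lemma L2form_savg_cst s f a : (0 < size s)%N ->
  B2 (savg U s f) (bmcst X a) = B2 f (bmcst X a).
Proof.
have BU := koopman_isometric_action muT.
move=> s0; rewrite (formZl BU) (form_suml BU).
under eq_bigr do rewrite L2form_koopman_cst.
rewrite big_const_seq count_predT iter_addr_0 -[B2 f _ *+ _]mulr_natl mulrA.
by rewrite mulVf ?mul1r// pnatr_eq0 -lt0n.
Qed.

(** The box averages [F n] take values in the unit interval and, for [n > 0], have integral [m].
    Equidistribution makes the positive part [h n] of [F n - c] tend to 0 almost everywhere, hence
    in mean by dominated convergence. Integrating [F n ^ 2 <= c F n + h n] gives the bound, as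
    [c m = (1 + delta) m ^ 2]. *)
Lemma equidistributed_energy q (delta : R) B (mB : measurable B) :
  0 <= delta -> equidistributed mu T q delta B ->
  forall tau : R, 0 < tau -> \forall n \near \oo,
    B2 (savg U (box q n) (bmindic R mB)) (savg U (box q n) (bmindic R mB)) <=
    (1 + delta) * fine (mu B) ^+ 2 + tau.
Proof.
move=> delta0 eqB tau tau0; pose m := fine (mu B); pose c := (1 + delta) * m.
have m0 : 0 <= m by exact: fine_ge0.
have mE : mu B = m%:E by rewrite fineK// fin_num_measure.
have c0 : 0 <= c by rewrite mulr_ge0// addr_ge0.
have sqr_le (a b : R) : 0 <= a <= 1 -> 0 <= b -> a - c <= b -> a * a <= c * a + b.
  by move=> /andP[]; nra.
have near_le (a L e : R) : `|L - a| <= e -> L <= c -> a - c <= e.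
  by rewrite ler_norml => /andP[]; lra.
pose F n := savg U (box q n) (bmindic R mB).
have F0 n x : 0 <= F n x.
  by rewrite savg_koopmanE mulr_ge0 ?invr_ge0// sumr_ge0.
have F1 n x : F n x <= 1.
  rewrite savg_koopmanE; have [->|s0] := eqVneq (size (box q n)) 0%N.
    by rewrite invr0 mul0r.
  rewrite ler_pdivrMl ?ltr0n ?lt0n// mulr1 -[leRHS]mulr1 mulr_natl.
  rewrite -iter_addr_0 -[X in iter X _]count_predT -big_const_seq.
  by apply: ler_sum => v _; rewrite /= indicE lern1 leq_b1.
pose h n x := Num.max (F n x - c) 0.
have mh n : measurable_fun setT (h n).
  apply: measurable_maxr => //; apply: measurable_funB => //.
  exact: measurable_bmfun.
have h0 n x : 0 <= h n x by rewrite le_max lexx orbT.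
have h1 n x : h n x <= 1 by rewrite ge_max ler01 andbT lerBlDr (le_trans (F1 n x))// lerDl.
have ih n : mu.-integrable setT (EFin \o h n).
  by apply: (@integrable_bounded _ _ _ _ _ 1) => // x; rewrite ger0_norm.
have hcvg : {ae mu, forall x, setT x -> (EFin \o h n) x @[n --> \oo] --> (cst 0%E x : \bar R)}.
  move: eqB; rewrite /equidistributed; apply: filterS => x [L [FL Lc]] _ /=.
  have {}Lc : L <= c by move: Lc; rewrite [X in (_ * X)%E]mE -EFinM lee_fin.
  apply: cvg_EFin; first by near=> n.
  apply/cvgrPdist_le => e e0; move/cvgrPdist_le : FL => /(_ _ e0).
  apply: filterS => n; rewrite freq_savg -/(F n) => Fn.
  rewrite sub0r normrN ger0_norm//=.
  by rewrite ge_max (ltW e0) andbT (near_le _ _ _ Fn).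
have icst : mu.-integrable setT (cst 1%E : X -> \bar R).
  by apply: (@integrable_bounded _ _ _ _ (cst 1) 1) => // x; rewrite normr1.
have hle : {ae mu, forall x n, setT x -> (`|(EFin \o h n) x| <= cst 1 x)%E}.
  by apply: aeW => x n _; rewrite /= lee_fin ger0_norm.
have mhE n : measurable_fun setT (EFin \o h n) by exact/measurable_EFinP.
have [_ _] := dominated_convergence measurableT mhE (measurable_cst _) hcvg icst hle.
rewrite integral0 => /fine_cvgP[_ /cvgrPdist_le/(_ _ tau0) htau].
near=> n.
have n0 : (0 < size (box q n))%N.
  by rewrite size_box expn_gt0; apply/orP; left; near: n; exists 1%N.
have hn : \int[mu]_x h n x <= tau.
  have : `|0 - fine (\int[mu]_x (EFin \o h n) x)%E| <= tau by near: n.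
  by rewrite sub0r normrN; apply: le_trans; exact: ler_norm.
have iF : mu.-integrable setT (EFin \o F n).
  apply: (@integrable_bounded _ _ _ _ _ 1); first exact: measurable_bmfun.
  by move=> x; rewrite ger0_norm.
have Fm : \int[mu]_x F n x = m.
  have := L2form_savg_cst (bmindic R mB) 1 n0; rewrite L2form_indic_cst -/m => <-.
  by apply: eq_Rintegral => x _; rewrite mulr1.
have icF : mu.-integrable setT (EFin \o (fun x => c * F n x)).
  apply: (@integrable_bounded _ _ _ _ _ c).
    by apply: measurable_funM => //; exact: measurable_bmfun.
  by move=> x; rewrite ger0_norm; [exact: ler_piMr|exact: mulr_ge0].
rewrite (@le_trans _ _ (\int[mu]_x (c * F n x + h n x)))//.
  apply: le_Rintegral => //; first exact: integrable_bmfunM.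
    by apply: eq_integrable (integrableD measurableT icF (ih n)).
  move=> x _; apply: (sqr_le (F n x) (h n x)) => //; first by rewrite F0 F1.
  by rewrite /h le_max lexx.
rewrite RintegralD// RintegralZl// Fm lerD// /c -mulrA -expr2.
by rewrite lexx.
Unshelve. all: by end_near. Qed.

End Equidistribution.

Theorem theorem4p1 (R : realType) (D r Q : nat) (eps : R) :
  (0 < D)%N -> (0 < r)%N -> (0 < Q)%N -> 0 < eps ->
  exists q : nat, (0 < q)%N /\
  forall (delta : R), 0 < delta <= 1 ->
  forall (P : 'I_r -> {poly int}),
    (forall i, (size (P i) <= D.+1)%N) ->
    mult_complexity D P Q ->
    hyperplane_fleeing R P ->
  forall (d : measure_display) (X : measurableType d) (mu : probability X R)
         (T : 'rV[int]_r -> X -> X) (B : set X),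
    mp_action mu T -> ergodic_action mu T ->
    measurable B -> equidistributed mu T q delta B ->
    (limn_esup (fun N => Lnorm mu 2%:E (EFin \o ergavg mu T P B N))
       <= (Num.sqrt (3 * delta) + eps)%:E)%E.
Proof.
move=> _ _ _ eps0; have eps20 : 0 < eps / 2 by rewrite divr_gt0.
have [q1 [q10 mean_ergodic]] := polynomial_mean_ergodic D eps20.
(* The factorial puts [q Z^r] inside the group generated by the [q1 c_j], [j >= 1]. *)
exists (q1 * Q`!)%N; split; first by rewrite muln_gt0 q10 fact_gt0.
move=> delta /andP[delta0 delta1] P PD PQ _ d X mu T B muT _ mB eqB.
set q := (q1 * Q`!)%N in eqB.
(* Here [a] and [e] are the squared norms of [f'] and of a box average, and the left side expands
   that of [f' - m]. The three [delta] come from near-minimality, from the limit in the box energy,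
   and from [delta * m ^+ 2]. *)
have energy_le (m a e : R) : 0 <= m <= 1 -> a <= e + delta ->
    e <= (1 + delta) * m ^+ 2 + delta ->
    1 ^+ 2 * a + 2 * (1 * - m) * m + (- m) ^+ 2 * 1 <= 3 * delta.
  move=> /andP[m0 m1] ae em.
  have dm : delta * m ^+ 2 <= delta by rewrite ler_piMr ?(ltW delta0)// expr_le1.
  by move: em dm; rewrite mulrDl mul1r; lra.
pose U := koopman muT; have BU := koopman_isometric_action muT.
pose f := bmindic R mB; pose m := fine (mu B); pose one := bmcst X (1 : R).
have m0 : 0 <= m by exact: fine_ge0.
have m1 : m <= 1.
  by rewrite -lee_fin fineK ?fin_num_measure// probability_le1.
pose L : set 'rV[int]_r := [set v | exists u, v = u *+ q].
have gL : subgroup L.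
  split; first by exists 0; rewrite mul0rn.
  by move=> _ _ [u ->] [v ->]; exists (u - v); rewrite mulrnBl.
have Llat : L `<=` lattice q1 (coef_row P) 1 D.+1.
  by move=> _ [u ->]; exact: mult_complexity_lattice.
have [t [tL tmin _]] := almost_minimal_savg BU f gL delta0.
have f1 : nrm (L2form mu) f <= 1.
  by apply: L2form_le1 => x; rewrite /= indicE ger0_norm// lern1 leq_b1.
pose f' := savg U t f; pose g := 2^-1 *: (f - f').
have g1 : nrm (L2form mu) g <= 1.
  rewrite (nrmZ BU) ger0_norm ?invr_ge0// ler_pdivrMl// mulr1.
  rewrite (le_trans (nrmB BU _ _))// (_ : 2 = 1 + 1)// lerD//.
  by rewrite (le_trans (nrm_savg BU _ _)).
have ng : null (L2form mu) U (lattice q1 (coef_row P) 1 D.+1) g.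
  apply: null_sub_group Llat _; apply: (nullZ BU); exact: null_sub_savg.
have one1 : L2form mu one one = 1.
  rewrite /L2form; under eq_Rintegral do rewrite /= mulr1.
  by rewrite Rintegral_cst// [X in fine X](probability_setT mu) mulr1.
have f'le : nrm (L2form mu) (f' - m *: one) <= Num.sqrt (3 * delta).
  have := equidistributed_energy muT mB (ltW delta0) eqB delta0.
  (* A single box is enough; the successor makes it non-empty. *)
  move=> [n0 _ /(_ n0.+1)] => /(_ (leqnSn n0)) energy.
  have /tmin tn : drawn_from L (box r q n0.+1).
    split; first by rewrite size_box expn_gt0.
    move=> _ /mapP[a _ ->]; exists (\row_i (a i).+1%:Z).
    by apply/rowP => i; rewrite mulmxnE !mxE PoszM -mulr_natl natz.
  rewrite ler_sqrt; last by rewrite mulr_ge0// ltW.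
  have -> : f' - m *: one = 1 *: f' + (- m) *: one by rewrite scale1r scaleNr.
  rewrite (form_sqrD BU) one1 (L2form_savg_cst muT) ?(proj1 tL)// L2form_indic_cst -/m.
  by apply: energy_le tn energy; rewrite m0 m1.
(* The shift 1 is there because [avg] starts at 0 and the ergodic average at 1. *)
have avgg := mean_ergodic _ _ _ _ BU (coef_row P) 1%N _ g1 ng.
apply: limn_esup_le_near; near=> N.
pose p n := zpoly (coef_row P) D (n + 1).
have -> : EFin \o ergavg mu T P B N = EFin \o (m *: one - avg N (fun n => U (p n) f) : bmfun X R).
  apply/funext => x /=; congr EFin.
  rewrite /ergavg; congr (_ - _); first exact/esym/mulr1.
  rewrite -[RHS]/(N%:R^-1 * _) (bmfun_sumE _ xpredT (fun n : 'I_N => U (p n) f)).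
  congr (_ * _); rewrite big_add1/= big_mkord; apply: eq_bigr => n _.
  by rewrite /= (polymap_zpoly _ PD) /p addn1.
rewrite Lnorm_bmfun lee_fin -(nrmN BU) opprB.
(* Constants are invariant, so the decomposition [f - m = 2 g + (f' - m)] passes to the averages;
   the last part is bounded termwise by isometry. *)
have -> : avg N (fun n => U (p n) f) - m *: one =
    2 *: avg N (fun n => U (p n) g) + avg N (fun n => U (p n) (f' - m *: one)).
  have N0 : N%:R != 0 :> R by rewrite pnatr_eq0 -lt0n; near: N; exists 1%N.
  have {1}-> : m *: one = avg N (fun n => U (p n) (m *: one)).
    rewrite /avg (eq_bigr (fun=> m *: one)); last by move=> n _; exact/val_inj.
    by rewrite sumr_const card_ord -[X in _ = _ *: X]scaler_nat [RHS]scalerA mulVf// scale1r.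
  rewrite -avgB /avg scalerA mulrC -scalerA [2 *: \sum_(_ < _) _]scaler_sumr.
  rewrite -scalerDr -big_split/=; congr (_ *: _); apply: eq_bigr => n _.
  rewrite -(act_sub BU) -(actZ BU) -(act_add BU); congr (koopman _ _ _).
  by rewrite scalerA divff// scale1r addrA subrK.
have hg : nrm (L2form mu) (avg N (fun n => U (p n) g)) <= eps / 2 by near: N.
have hf' : nrm (L2form mu) (avg N (fun n => U (p n) (f' - m *: one))) <= Num.sqrt (3 * delta).
  by apply: (nrm_avg BU) => [|n]; [exact: sqrtr_ge0|rewrite (nrm_act BU)].
rewrite (le_trans (nrmD BU _ _))// (nrmZ BU) ger0_norm// addrC lerD//.
by rewrite -ler_pdivlMl// mulrC.
Unshelve. all: by end_near. Qed.
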